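(* Let $n\geq 2$ be an integer and let $P\colon\mathbb{C}^n\to\mathbb{R}$ be a non-constant plurisubharmonic polynomial without pluriharmonic terms, and assume that $P$ is homogeneous of degree $2k$, $k\in\mathbb{Z}_{\geq 1}$. Let $1\leq l\leq n-1$ and assume that $P$ is homogeneous of degree $2d_j$, $d_j\in\mathbb{Z}_{>0}$, in $z_j,\overline{z_j}$ for $j=1,\dots,l$. Assume furthermore that $k-D>0$, where $D=d_1+\dots+d_l$. Write $d:=\gcd(d_1,\dots,d_l,k)\in\mathbb{Z}_{\geq 1}$. Then there exists a plurisubharmonic polynomial $Q\colon\mathbb{C}^{n-l}\to\mathbb{R}$ without pluriharmonic terms, homogeneous of degree $2k-2D$, with the property that both the holomorphic and the anti-holomorphic degree of every term appearing in $Q$ are divisible by the integer $(k-D)/d$, such that for all $(z_1,\dots,z_n)\in\mathbb{C}^n$: $$P(z_1,\dots,z_n)=Q(\tau z_{l+1},\dots,\tau z_n)$$ for every solution $\tau\in\mathbb{C}$ of $\tau^{(k-D)/d}=z_1^{d_1/d}\cdots z_l^{d_l/d}$.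
   Context: A polynomial $\mathbb{C}^n\to\mathbb{R}$ means a real-valued polynomial in the coordinates and their complex conjugates, written $P(z)=\sum a_{\alpha,\beta}z^\alpha\overline{z}^\beta$ with multi-indices $\alpha,\beta\in(\mathbb{Z}_{\geq 0})^n$. Homogeneous of degree $2k$ means $\mathbb{R}$-homogeneous: $a_{\alpha,\beta}\neq 0$ implies $|\alpha|+|\beta|=2k$. ''Without pluriharmonic terms'' means that no purely holomorphic or purely anti-holomorphic terms appear, i.e. $a_{\alpha,\beta}\neq 0$ implies $|\alpha|>0$ and $|\beta|>0$. If $a_{\alpha,\beta}\neq 0$, then $|\alpha|$ (resp. $|\beta|$) is called the holomorphic (resp. anti-holomorphic) degree of the term $a_{\alpha,\beta}z^\alpha\overline{z}^\beta$. $P$ is homogeneous of degree $2d_j$ in $z_j,\overline{z_j}$ if $\alpha_j+\beta_j=2d_j$ for every $(\alpha,\beta)$ with $a_{\alpha,\beta}\neq 0$. *)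

(* Defs.v *)
From HB Require Import structures.
From mathcomp Require Import all_boot all_order all_algebra.
From mathcomp Require Import all_classical all_reals all_analysis.
From mathcomp Require Import complex.
(* [mpoly]'s notations clash with those of MathComp-Analysis. *)
From mathcomp Require mpoly.
Export -(notations) mpoly.

Set Implicit Arguments.
Unset Strict Implicit.
Unset Printing Implicit Defensive.

Import Order.TTheory GRing.Theory Num.Theory numFieldNormedType.Exports.
Local Open Scope ring_scope.
Local Open Scope classical_set_scope.
Local Open Scope complex_scope.

Definition cexpi (R : realType) (t : R) : R[i] := cos t +i* sin t.

(* The topology of C is carried by the copy R[i]^o of R[i].  The integral is
   extended-real-valued and f is bounded above on compact sets, so the
   sub-mean value inequality is meaningful without an integrability
   hypothesis. *)
Definition plurisubharmonic (R : realType) (n : nat)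
    (f : 'rV[R[i]]_n -> R) : Prop :=
  lower_semicontinuous (fun z : 'rV[R[i]^o]_n => (- f z)%:E) /\
  forall a b : 'rV[R[i]]_n,
    ((2 * pi * f a)%R%:E <=
     \int[lebesgue_measure]_(t in `[0%R, (2 * pi)%R])
       (f (a + cexpi t *: b))%:E)%E.

(* A polynomial sum a_(alpha,beta) z^alpha zbar^beta is represented by an
   [mpoly] in n + n variables: variable [lshift n j] stands for z_j and
   variable [rshift n j] for the conjugate of z_j. *)
Definition cpoly (R : realType) (n : nat) := mpoly (n + n) R[i].

Section CPoly.
Variables (R : realType) (n : nat).
Implicit Types (P : cpoly R n) (m : multinom (n + n)) (z : 'rV[R[i]]_n).

Definition hexp m (j : 'I_n) : nat := m (lshift n j).
Definition aexp m (j : 'I_n) : nat := m (rshift n j).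

Definition hdeg m : nat := (\sum_(j < n) hexp m j)%N.
Definition adeg m : nat := (\sum_(j < n) aexp m j)%N.

Definition ceval P z : R[i] :=
  meval (fun i : 'I_(n + n) =>
           match fintype.split i with
           | inl j => z ord0 j
           | inr j => conjc (z ord0 j)
           end) P.

Definition real_valued P : Prop := forall z, complex.Im (ceval P z) = 0.

Definition psh_poly P : Prop :=
  real_valued P /\ plurisubharmonic (fun z => complex.Re (ceval P z)).

Definition no_pluriharmonic_terms P : Prop :=
  forall m, mcoeff m P != 0 -> (0 < hdeg m)%N /\ (0 < adeg m)%N.

Definition homogeneous (e : nat) P : Prop :=
  forall m, mcoeff m P != 0 -> (hdeg m + adeg m = e)%N.

Definition homogeneous_in (j : 'I_n) (e : nat) P : Prop :=
  forall m, mcoeff m P != 0 -> (hexp m j + aexp m j = e)%N.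

End CPoly.

Section Splitting.
Variables (n l : nat) (le_ln : (l <= n)%N).

Definition head_ord (j : 'I_l) : 'I_n := widen_ord le_ln j.

Definition tail_ord (j : 'I_(n - l)) : 'I_n :=
  cast_ord (subnKC le_ln) (rshift l j).

Definition tail_vec (T : Type) (z : 'rV[T]_n) : 'rV[T]_(n - l) :=
  \row_j z ord0 (tail_ord j).

End Splitting.

(* Main.v *)
Require Import Defs.
From mathcomp Require Import all_boot all_order all_algebra.
From mathcomp Require Import all_classical all_reals all_analysis.
From mathcomp Require Import cyclic separable cyclotomic complex ring lra zify.
Set Implicit Arguments.
Unset Strict Implicit.
Unset Printing Implicit Defensive.
Import Order.TTheory GRing.Theory Num.Theory numFieldNormedType.Exports.
Local Open Scope ring_scope.
Local Open Scope complex_scope.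

(** Only balanced terms of [P] contribute to its values: if [c * z^alpha *
    zbar^beta] is such a term, [T] is the part of [|alpha|] carried by the
    last [n - l] variables and [M = k - D], then [M * alpha_j = d_j * T] for
    every [j] among the first [l] indices, and similarly for [beta].  A gcd
    computation ([balanced_exponents]) then yields an [s] with [T = (M / g) *
    s] and [alpha_j = (d_j / g) * s], so that setting [Q (w) = P (1, ..., 1,
    w)] gives the required polynomial: when [tau ^ (M / g)] is the product of
    the [z_j ^ (d_j / g)], the factor [tau ^ T] of a term of [Q (tau z'')] is
    the product of the [z_j ^ alpha_j].

    For the balance relation, fix [j] and let a complex number [t] act on
    [C^n] by multiplying [z_j] by [e^(M t)] and the last [n - l] coordinates
    by [e^(- d_j t)].  The homogeneity hypotheses imply that [P] is invariant
    for real [t]; hence along an orbit [P] is a subharmonic function of [Im t]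
    alone, that is a convex function, which is moreover periodic, hence
    constant.  A term with [u = M * alpha_j - d_j * T] is multiplied by [e^(2
    i u s)] when [t = i s], so that only the terms with [u = 0] contribute to
    [P].

    Convexity is expressed by the Levi form.  In the direction [(lam_j *
    z_j)_j] tangent to the orbit, the mean of [P] over circles of radius [e]
    is a polynomial in [e^2] whose linear coefficient multiplies each term by
    [u * v], where [v = - u] is the analogue of [u] for [beta]; the sub-mean
    value inequality makes this coefficient nonnegative ([levi_ge0]).  That a
    trigonometric polynomial with nonnegative second derivative is constant is
    [trig_rigidity], proved by averaging over roots of unity.  The two are
    combined in [balanced_ceval].  The argument works with values of [P] only:
    unbalanced terms are discarded, one index [j] after the other, without
    changing the function ([balanced_subpoly]). *)

(** * Means of trigonometric polynomials over the unit circle *)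

Lemma Re_sum (R : realType) (I : Type) (r : seq I) (Q : pred I) (F : I -> R[i]) :
  complex.Re (\sum_(i <- r | Q i) F i) = \sum_(i <- r | Q i) complex.Re (F i).
Proof. exact: (raddf_sum (@complex.Re R : Rcomplex R -> R)). Qed.

Lemma Im_sum (R : realType) (I : Type) (r : seq I) (Q : pred I) (F : I -> R[i]) :
  complex.Im (\sum_(i <- r | Q i) F i) = \sum_(i <- r | Q i) complex.Im (F i).
Proof. exact: (raddf_sum (@complex.Im R : Rcomplex R -> R)). Qed.

Lemma Re_realM (R : realType) (x : R) (c : R[i]) :
  complex.Re (x%:C * c) = x * complex.Re c.
Proof. by case: c => a b; rewrite /= mul0r subr0. Qed.

Lemma mulcJE (R : realType) (x : R[i]) : x * conjc x = (`|x| ^+ 2).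
Proof. by case: x => a b; rewrite -add_Re2_Im2 /=; simpc; congr (_ +i* _); ring. Qed.

Lemma is_derive_mull (R : realType) (c t : R) :
  is_derive t 1 (fun x : R => c * x) c.
Proof.
have d1 := @is_derive_id R R t 1; have := is_deriveZ c d1.
by rewrite /GRing.scale /= mulr1.
Qed.

(** [h] is continuous and has mean [c] over [[0, 2 * pi]].  The mean is encoded
    by an antiderivative, which makes the notion trivially additive. *)
Definition circle_mean (R : realType) (h : R -> R) (c : R) : Prop :=
  continuous h /\
  exists H : R -> R, (forall t : R, is_derive t 1 H (h t)) /\
    H (2 * pi) - H 0 = 2 * pi * c.

Lemma circle_mean_integral (R : realType) (h : R -> R) (c : R) :
  circle_mean h c ->
  (\int[lebesgue_measure]_(t in `[0%R, (2 * pi)%R]%classic) (h t)%:E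
   = (2 * pi * c)%R%:E)%E.
Proof.
move=> [ch [H [dH HE]]].
have pi2 : (0 : R) < 2 * pi by rewrite mulr_gt0 ?pi_gt0.
have cH : continuous H.
  move=> t; apply: differentiable_continuous; apply/derivable1_diffP.
  by have [] := dH t.
rewrite (continuous_FTC2 (F := H) pi2) //.
- by rewrite -EFinB; congr (_%:E); exact: HE.
- exact: continuous_subspaceT.
- split.
  + by move=> t _; have [] := dH t.
  + by apply: cvg_at_right_filter; exact: cH.
  + by apply: cvg_at_left_filter; exact: cH.
- by move=> t _; rewrite derive1E; have [_] := dH t.
Qed.

Lemma circle_mean_ext (R : realType) (h h' : R -> R) (c : R) :
  h =1 h' -> circle_mean h c -> circle_mean h' c.
Proof. by move=> /funext ->. Qed.

Lemma circle_meanD (R : realType) (h h' : R -> R) (c c' : R) :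
  circle_mean h c -> circle_mean h' c' ->
  circle_mean (fun t => h t + h' t) (c + c').
Proof.
move=> [ch [H [dH HE]]] [ch' [H' [dH' HE']]]; split.
  by move=> t; apply: cvgD; [exact: ch|exact: ch'].
exists (H + H'); split; first by move=> t; apply: is_deriveD.
have -> : 2 * pi * (c + c') = 2 * pi * c + 2 * pi * c' by ring.
by rewrite !fctE -HE -HE'; ring.
Qed.

Lemma circle_mean_cst (R : realType) (c : R) : circle_mean (fun=> c) c.
Proof.
split; first by move=> t; exact: cvg_cst.
exists (fun t => c * t); split; first by move=> t; exact: is_derive_mull.
by ring.
Qed.

Lemma circle_mean_sum (R : realType) (I : Type) (r : seq I) (h : I -> R -> R)
    (c : I -> R) : (forall i, circle_mean (h i) (c i)) ->
  circle_mean (fun t => \sum_(i <- r) h i t) (\sum_(i <- r) c i).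
Proof.
move=> hc; elim: r => [|i r IH].
  rewrite big_nil; apply: circle_mean_ext (circle_mean_cst 0) => t.
  by rewrite big_nil.
rewrite big_cons; apply: circle_mean_ext (circle_meanD (hc i) IH) => t.
by rewrite big_cons.
Qed.

Lemma cexpiD (R : realType) (s t : R) : cexpi (s + t) = cexpi s * cexpi t.
Proof. by rewrite /cexpi cosD sinD; simpc; congr (_ +i* _); ring. Qed.

Lemma cexpiX (R : realType) (t : R) (j : nat) :
  cexpi t ^+ j = cexpi (t *+ j).
Proof.
elim: j => [|j IH]; first by rewrite expr0 mulr0n /cexpi cos0 sin0.
by rewrite exprS mulrS cexpiD IH.
Qed.

Lemma cexpi_conj (R : realType) (t : R) : cexpi t * conjc (cexpi t) = 1.
Proof.
rewrite /cexpi /=; simpc; congr (_ +i* _); last by ring.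
by rewrite -!expr2 cos2Dsin2.
Qed.

Lemma circle_mean_expi (R : realType) (a : R[i]) (j : nat) :
  circle_mean (fun t => complex.Re (a * cexpi t ^+ j))
    (if j == 0%N then complex.Re a else 0).
Proof.
have [->|j_gt0] := posnP j.
  by apply: circle_mean_ext (circle_mean_cst _) => t; rewrite expr0 mulr1.
case: a => x y.
apply: (@circle_mean_ext _
  (fun t => x * cos (j%:R * t) - y * sin (j%:R * t))).
  by move=> t; rewrite cexpiX /cexpi /= mulr_natl.
have jn0 : j%:R != 0 :> R by rewrite pnatr_eq0 -lt0n.
have jd (t : R) := is_derive_mull (j%:R) t.
have cj : continuous (fun t : R => j%:R * t).
  by move=> t; apply: cvgM; [exact: cvg_cst|exact: cvg_id].
have dsin (t : R) :
    is_derive t 1 (fun t => sin (j%:R * t)) (j%:R * cos (j%:R * t)).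
  by have := is_derive1_comp (is_derive_sin _) (jd t); rewrite mulrC.
have dcos (t : R) :
    is_derive t 1 (fun t => cos (j%:R * t)) (j%:R * - sin (j%:R * t)).
  by have := is_derive1_comp (is_derive_cos _) (jd t); rewrite mulrC.
split.
  move=> t; apply: cvgB; apply: cvgM; try exact: cvg_cst.
    exact: (continuous_comp (cj t) (@continuous_cos R _)).
  exact: (continuous_comp (cj t) (@continuous_sin R _)).
exists (fun t => x / j%:R * sin (j%:R * t) + y / j%:R * cos (j%:R * t)); split.
  move=> t; apply: (is_derive_eq (is_deriveD
    (is_deriveZ (x / j%:R) (dsin t)) (is_deriveZ (y / j%:R) (dcos t)))).
  by rewrite /GRing.scale /=; field.
have e1 : cexpi (2 * pi) ^+ j = 1 :> R[i].
  rewrite /cexpi !mulr_natl cos2pi sin2pi; exact: expr1n.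
move: e1; rewrite cexpiX /cexpi -[(2 * pi) *+ j]mulr_natl => -[c1 s0].
by rewrite c1 s0 !mulr0 sin0 cos0; ring.
Qed.

Lemma circle_mean_monomial (R : realType) (a : R[i]) (k l : nat) :
  circle_mean (fun t => complex.Re (a * cexpi t ^+ k * conjc (cexpi t) ^+ l))
    (if k == l then complex.Re a else 0).
Proof.
have cancel (c : R[i]) (t : R) (i j : nat) : (i <= j)%N ->
    c * cexpi t ^+ j * conjc (cexpi t) ^+ i = c * cexpi t ^+ (j - i).
  move=> ij; rewrite -{1}(subnK ij) exprD !mulrA -mulrA -exprMn.
  by rewrite cexpi_conj expr1n mulr1.
have [kl|/ltnW lk] := leqP k l; last first.
  have := circle_mean_expi a (k - l).
  have -> : (k - l == 0)%N = (k == l) by lia.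
  by apply: circle_mean_ext => t; rewrite cancel.
have := circle_mean_expi (conjc a) (l - k).
have -> : (l - k == 0)%N = (k == l) by lia.
have ReJ (x : R[i]) : complex.Re (conjc x) = complex.Re x by case: x.
rewrite ReJ; apply: circle_mean_ext => t; rewrite -cancel //.
by rewrite -[RHS]ReJ !rmorphM !rmorphXn /= opprK mulrAC.
Qed.

(** Expanding both factors, only the products of terms of equal degrees have a
    nonzero mean. *)
Lemma circle_mean_poly (R : realType) (K : nat) (A B : {poly R[i]})
    (y : R[i]) (e : R) : (size A <= K)%N -> (size B <= K)%N ->
  circle_mean
    (fun t => complex.Re (y * (A.[e%:C * cexpi t] * B.[e%:C * conjc (cexpi t)])))
    (\sum_(k < K) complex.Re (y * (A`_k * B`_k)) * (e ^+ 2) ^+ k).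
Proof.
move=> sA sB.
have := circle_mean_sum (index_enum 'I_K)
  (fun k => circle_mean_sum (index_enum 'I_K)
    (fun l => circle_mean_monomial
      (y * (A`_(k : 'I_K) * B`_(l : 'I_K)) * e%:C ^+ (k + l)) k l)).
set c := \sum_(k <- _) _.
rewrite (_ : c = \sum_(k < K) complex.Re (y * (A`_k * B`_k)) * (e ^+ 2) ^+ k).
  apply: circle_mean_ext => t.
  rewrite (horner_coef_wide _ sA) (horner_coef_wide _ sB).
  rewrite mulr_suml mulr_sumr Re_sum; apply: eq_bigr => k _.
  rewrite !mulr_sumr Re_sum; apply: eq_bigr => l _; congr (complex.Re _).
  by rewrite !exprMn exprD; ring.
apply: eq_bigr => k _; rewrite (bigD1 k) //= eqxx big1 ?addr0.
  by rewrite addnn -mul2n exprM -!rmorphXn mulrC Re_realM mulrC.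
by move=> l /negPf; rewrite -val_eqE /= eq_sym => ->.
Qed.

(** * Trigonometric polynomials with nonnegative second derivative *)

Lemma prim_root_exists (F : closedFieldType) (n : nat) :
  n%:R != 0 :> F -> exists w : F, n.-primitive_root w.
Proof.
move=> nF0; have n_gt0 : (0 < n)%N by case: n nF0 => //; rewrite eqxx.
pose p : {poly F} := 'X^n - 1; have [r Dp] := closed_field_poly_normal p.
rewrite (monicP _) ?monicXnsubC // scale1r in Dp.
have rn1 : all n.-unity_root r by apply/allP=> z; rewrite -root_prod_XsubC -Dp.
have sz_r : (n < (size r).+1)%N.
  by rewrite -(size_prod_XsubC r id) -Dp size_XnsubC.
have [|z] := hasP (has_prim_root n_gt0 rn1 _ sz_r); last by exists z.
by rewrite -separable_prod_XsubC -Dp separable_Xn_sub_1.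
Qed.

Lemma sum_prim_root (F : fieldType) (n j : nat) (w : F) :
  n.-primitive_root w -> \sum_(k < n) (w ^+ k) ^+ j = (n %| j)%:R * n%:R.
Proof.
move=> pw; rewrite (prim_order_dvd pw).
under eq_bigr do rewrite -exprM mulnC exprM.
have [->|wj1] := eqVneq (w ^+ j) 1.
  under eq_bigr do rewrite expr1n.
  by rewrite sumr_const card_ord mul1r.
have := subrX1 (w ^+ j) n; rewrite -exprM mulnC exprM (prim_expr_order pw).
rewrite expr1n subrr => /esym/eqP; rewrite mulf_eq0 subr_eq0 (negPf wj1) /=.
by move=> /eqP->; rewrite mul0r.
Qed.

Lemma prim_root_conj (R : realType) (n : nat) (w : R[i]) :
  n.-primitive_root w -> w * conjc w = 1.
Proof.
move=> pw; have n_gt0 := prim_order_gt0 pw.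
rewrite mulcJE; have : `|w| ^+ n = 1 by rewrite -normrX (prim_expr_order pw) normr1.
by move/eqP; rewrite pexpr_eq1 ?normr_ge0 -?lt0n // => /eqP->; rewrite expr1n.
Qed.

Lemma unit_conjX (R : realType) (w : R[i]) (k : nat) :
  w * conjc w = 1 -> w ^+ k * conjc (w ^+ k) = 1.
Proof. by move=> w1; rewrite rmorphXn /= -exprMn w1 expr1n. Qed.

(** Orthogonality of the characters [w ^ p * wbar ^ (2 E - p) = w ^ (2 (p - E))]
    on the roots of unity of order [2 E + 1]: this order is odd and exceeds
    every [2 * |p - E|], so only [p = E] survives. *)
Lemma sum_prim_root_balanced (R : realType) (E p : nat) (w : R[i]) :
  (2 * E).+1.-primitive_root w -> (p <= 2 * E)%N ->
  \sum_(k < (2 * E).+1) (w ^+ k) ^+ p * conjc (w ^+ k) ^+ (2 * E - p)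
  = (p == E)%:R * (2 * E).+1%:R.
Proof.
move=> pw pE; have w1 := prim_root_conj pw.
have wJ : conjc w = w ^+ (2 * E).
  have := prim_expr_order pw; rewrite exprS => w2.
  by rewrite -[LHS]mulr1 -w2 mulrA (mulrC (conjc w)) w1 mul1r.
pose j := (p + (2 * E) * (2 * E - p))%N.
transitivity (\sum_(k < (2 * E).+1) (w ^+ k) ^+ j).
  apply: eq_bigr => k _; rewrite exprD; congr (_ * _).
  have -> : conjc (w ^+ k) = (w ^+ k) ^+ (2 * E).
    by rewrite (rmorphXn (@conjc R)) /= wJ -!exprM mulnC.
  by rewrite -exprM.
rewrite (sum_prim_root _ pw); congr ((nat_of_bool _)%:R * _).
apply/idP/eqP => [|pE0]; last first.
  rewrite /j pE0 (_ : (E + _)%N = ((2 * E).+1 * E)%N) ?dvdn_mulr //; nia.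
case/dvdnP => q jq.
have [pE'|Ep] := leqP p E.
- have : ((2 * E).+1 %| 2 * (E - p))%N.
    apply/dvdnP; exists (2 * E - p - q)%N; nia.
  by case: (posnP (2 * (E - p))) => [|x0 /dvdn_leq-/(_ x0)]; lia.
- have : ((2 * E).+1 %| 2 * (p - E))%N.
    apply/dvdnP; exists (q - (2 * E - p))%N; nia.
  by case: (posnP (2 * (p - E))) => [|x0 /dvdn_leq-/(_ x0)]; lia.
Qed.

(** On the unit circle, let [f w] be the sum of the
    [y i * w ^ p i * wbar ^ (2 E - p i)].  If [f] is real and its second
    angular derivative is nonnegative (the second hypothesis, up to the factor
    [-4]), then [f] equals its mean; the conclusion is this equality at
    [w = 1]. *)
Lemma trig_rigidity (R : realType) (I : eqType) (r : seq I) (y : I -> R[i])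
    (p : I -> nat) (E : nat) :
  (forall i, i \in r -> (p i <= 2 * E)%N) ->
  (forall w : R[i], w * conjc w = 1 ->
     complex.Re (\sum_(i <- r) ((p i)%:R - E%:R) ^+ 2 *
       (y i * (w ^+ p i * conjc w ^+ (2 * E - p i)))) <= 0) ->
  (forall w : R[i], w * conjc w = 1 ->
     complex.Im (\sum_(i <- r) y i * (w ^+ p i * conjc w ^+ (2 * E - p i))) = 0) ->
  \sum_(i <- r) y i = \sum_(i <- r | p i == E) y i.
Proof.
move=> pE hle him; set N := (2 * E).+1.
have N0 : N%:R != 0 :> R[i] by rewrite pnatr_eq0.
have [w pw] := prim_root_exists N0.
have w1 k : w ^+ k * conjc (w ^+ k) = 1 by exact/unit_conjX/(prim_root_conj pw).
have avg (c : I -> R[i]) :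
    \sum_(k < N) \sum_(i <- r) c i *
      ((w ^+ k) ^+ p i * conjc (w ^+ k) ^+ (2 * E - p i)) =
    N%:R * \sum_(i <- r | p i == E) c i.
  rewrite exchange_big /= mulr_sumr [RHS]big_mkcond /=; apply: eq_big_seq => i ir.
  rewrite -mulr_sumr sum_prim_root_balanced ?pE //.
  by case: eqP; rewrite ?mul1r ?mul0r ?mulr0 // mulrC.
pose d i : R[i] := ((p i)%:R - E%:R) ^+ 2.
pose h v := \sum_(i <- r) d i * y i * (v ^+ p i * conjc v ^+ (2 * E - p i)).
(* The real part of [h] is nonpositive and averages to [0] over the roots of
   unity, because [d i] kills the terms with [p i = E]. *)
have h0 k : (k < N)%N -> complex.Re (h (w ^+ k)) = 0.
  have hk j : complex.Re (h (w ^+ j)) <= 0.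
    rewrite /h; under eq_bigr do rewrite -mulrA.
    exact: hle.
  have : \sum_(k < N) - complex.Re (h (w ^+ k)) = 0.
    rewrite sumrN -Re_sum avg big1 ?mulr0 ?oppr0 // => i /eqP piE.
    by rewrite /d piE subrr expr0n mul0r.
  move=> /psumr_eq0P s0 kN.
  by apply/eqP; rewrite -oppr_eq0 (s0 _ (Ordinal kN)) // => j _; rewrite oppr_ge0.
pose q0 : {poly R[i]} :=
  \sum_(i <- r) (y i *: 'X^(p i) + conjc (y i) *: 'X^(2 * E - p i)).
(* For a root of unity [v], [2 * Re (h v)] is [q.[v ^+ 2] / v ^+ (2 * E)]. *)
pose q : {poly R[i]} :=
  \sum_(i <- r) d i *: (y i *: 'X^(p i) + conjc (y i) *: 'X^(2 * E - p i)).
have dJ i : conjc (d i) = d i by rewrite /d rmorphXn rmorphB /= !conjc_nat.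
have monoJ v i : conjc (d i * y i * (v ^+ p i * conjc v ^+ (2 * E - p i))) =
    d i * conjc (y i) * (conjc v ^+ p i * v ^+ (2 * E - p i)).
  move: (d i) (dJ i) => c cJ.
  by rewrite !rmorphM !rmorphXn /= conjcK cJ.
have q_eq0 : q = 0.
  have pw2 : N.-primitive_root (w ^+ 2).
    by rewrite prim_root_exp_coprime // coprime2n /N /= mul2n odd_double.
  apply: (roots_geq_poly_eq0 (rs := [seq (w ^+ 2) ^+ k | k <- iota 0 N])).
  - apply/allP => x /mapP[k]; rewrite mem_iota /= => kN ->.
    rewrite -exprM mulnC exprM; set v := w ^+ k; have v1 : v * conjc v = 1 := w1 k.
    have : h v + conjc (h v) = 0 by rewrite addcJ h0 // mulr0.
    rewrite /h rmorph_sum -big_split /= => /(congr1 ( *%R (v ^+ (2 * E)))).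
    rewrite mulr0 mulr_sumr => s0; apply/eqP; rewrite -[RHS]s0 /q horner_sum.
    apply: eq_big_seq => i ir; rewrite hornerZ hornerD !hornerZ !hornerXn.
    have -> : v ^+ (2 * E) = v ^+ p i * v ^+ (2 * E - p i).
      by rewrite -exprD subnKC ?pE.
    rewrite monoJ -!exprM ![(2 * _)%N]mulnC !exprM.
    have e1 : v ^+ (E * 2 - p i) * conjc v ^+ (E * 2 - p i) = 1.
      by rewrite -exprMn v1 expr1n.
    have e2 : v ^+ p i * conjc v ^+ p i = 1 by rewrite -exprMn v1 expr1n.
    ring: e1 e2.
  - rewrite map_inj_in_uniq ?iota_uniq // => j k; rewrite !mem_iota /= => jN kN.
    by move/eqP; rewrite (eq_prim_root_expr pw2) !modn_small // => /eqP.
  - rewrite size_map size_iota; apply/leq_sizeP => e Ee.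
    rewrite coef_sum big1_seq // => i /andP[_ ir].
    rewrite !(coefE, coefXn); have := pE _ ir => pi_le.
    rewrite (_ : (e == p i) = false); last by lia.
    rewrite (_ : (e == 2 * E - p i)%N = false); last by lia.
    by rewrite !mulr0 addr0 mulr0.
(* [q`_e] is [(e - E)^2 * q0`_e], so [q0] is reduced to its middle term. *)
have q0E : q0 = q0`_E *: 'X^E.
  apply/polyP => e; rewrite coefZ coefXn.
  have [->|eE] := eqVneq e E; first by rewrite mulr1.
  rewrite mulr0; have /polyP/(_ e) := q_eq0; rewrite coef0.
  have -> : q`_e = (e%:R - E%:R) ^+ 2 * q0`_e.
    rewrite !coef_sum mulr_sumr; apply: eq_big_seq => i ir.
    rewrite !(coefE, coefXn) /d.
    have [e1|_] := eqVneq e (p i); have [e2|_] := eqVneq e (2 * E - p i)%N.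
    + by rewrite -e1.
    + by rewrite -e1.
    + rewrite {1}e2 natrB ?pE // natrM; ring.
    + by rewrite !mulr0 addr0 !mulr0.
  move/eqP; rewrite mulf_eq0 expf_eq0 /= subr_eq0 eqr_nat (negPf eE).
  by move/eqP.
have SE : \sum_(i <- r) (y i + conjc (y i)) =
    \sum_(i <- r | p i == E) (y i + conjc (y i)).
  have /(congr1 (horner^~ 1)) := q0E.
  rewrite hornerZ hornerXn expr1n mulr1 horner_sum coef_sum.
  rewrite (eq_bigr (fun i => y i + conjc (y i))); last first.
    by move=> i _; rewrite !(hornerE, hornerXn) !expr1n !mulr1.
  move=> ->; rewrite [RHS]big_mkcond /=; apply: eq_big_seq => i ir.
  have := pE _ ir => pi_le; rewrite !(coefE, coefXn).
  rewrite (_ : (E == 2 * E - p i)%N = (p i == E)); last by lia.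
  rewrite (eq_sym E).
  by case: (p i == E); rewrite ?mulr1 ?mulr0 ?addr0.
have reE : complex.Re (\sum_(i <- r) y i) =
    complex.Re (\sum_(i <- r | p i == E) y i).
  have := congr1 (@complex.Re R) SE; rewrite !Re_sum.
  rewrite (eq_bigr (fun i => 2 * complex.Re (y i))); last first.
    by move=> i _; case: (y i) => a b /=; ring.
  rewrite [in RHS](eq_bigr (fun i => 2 * complex.Re (y i))); last first.
    by move=> i _; case: (y i) => a b /=; ring.
  by rewrite -!mulr_sumr => /mulfI; apply; rewrite pnatr_eq0.
have imL : complex.Im (\sum_(i <- r) y i) = 0.
  have := him 1; rewrite conjc1 mulr1 => /(_ erefl) <-; congr complex.Im.
  by apply: eq_bigr => i _; rewrite !expr1n !mulr1.
have imR : complex.Im (\sum_(i <- r | p i == E) y i) = 0.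
  have : complex.Im (N%:R * \sum_(i <- r | p i == E) y i) = 0.
    by rewrite -avg Im_sum; apply: big1 => k _; exact: him.
  have -> : (N%:R : R[i]) = (N%:R : R)%:C by rewrite rmorph_nat.
  case: (\sum_(i <- r | _) _) => a b /=; rewrite mul0r addr0 => /eqP.
  by rewrite mulf_eq0 pnatr_eq0 /= => /eqP.
by apply/eqP; rewrite eq_complex reE imL imR !eqxx.
Qed.

(** * The Levi form in a logarithmic direction *)

(** The value at [z] of the monomial [z^alpha * zbar^beta] encoded by [m]. *)
Definition cmon (R : realType) (n : nat) (m : multinom (n + n))
    (z : 'rV[R[i]]_n) : R[i] :=
  (\prod_(j < n) z ord0 j ^+ hexp m j) *
  (\prod_(j < n) conjc (z ord0 j) ^+ aexp m j).

Lemma meval_cmon (R : realType) (n : nat) (m : multinom (n + n))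
    (z : 'rV[R[i]]_n) :
  \prod_(i < n + n) (match fintype.split i with
     | inl j => z ord0 j
     | inr j => conjc (z ord0 j)
     end) ^+ m i = cmon m z.
Proof.
rewrite big_split_ord /cmon /=; congr (_ * _); apply: eq_bigr => j _.
  by rewrite (unsplitK (inl j : 'I_n + 'I_n)).
by rewrite (unsplitK (inr j : 'I_n + 'I_n)).
Qed.

Lemma cevalE (R : realType) (n : nat) (P : cpoly R n) (z : 'rV[R[i]]_n) :
  ceval P z = \sum_(m <- msupp P) mcoeff m P * cmon m z.
Proof. by rewrite /ceval mevalE; under eq_bigr do rewrite meval_cmon. Qed.

Lemma cmon_mul (R : realType) (n : nat) (m : multinom (n + n))
    (c z : 'rV[R[i]]_n) :
  cmon m (\row_j (c ord0 j * z ord0 j)) = cmon m c * cmon m z.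
Proof.
rewrite /cmon mulrACA -[X in _ = X * _]big_split -[X in _ = _ * X]big_split /=.
by congr (_ * _); apply: eq_bigr => j _; rewrite mxE ?rmorphM /= exprMn.
Qed.

Lemma coef1_ge0 (R : realType) (p : {poly R}) :
  (forall e : R, p.[0] <= p.[e ^+ 2]) -> 0 <= p`_1.
Proof.
move=> hp.
have /factor_theorem[q qE] : root (p - p.[0]%:P) 0.
  by apply/rootP; rewrite hornerD hornerN hornerC subrr.
have -> : p`_1 = q.[0].
  have := congr1 (fun f : {poly R} => f`_1) qE.
  by rewrite coefB coefC subr0 => ->; rewrite subr0 coefMX horner_coef0.
have q0 : (horner q @ (0 : R)^'+ --> q.[0])%classic.
  by apply: cvg_at_right_filter; exact: continuous_horner.
apply: (cvgr_to_ge q0); near=> s.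
have s0 : 0 < s by near: s; exact: nbhs_right_gt.
have ps : p.[0] <= p.[s] by have := hp (Num.sqrt s); rewrite (sqr_sqrtr (ltW s0)).
have := congr1 (horner^~ s) qE; rewrite hornerM !(hornerE) => e.
by rewrite -(pmulr_lge0 _ s0); lra.
Unshelve. all: by end_near. Qed.

(** The polynomial [prod_j (1 + lam_j X) ^ al_j]: its value at [x] is the
    factor by which [z^al] is multiplied when each [z_j] becomes
    [z_j + x * lam_j * z_j]. *)
Definition linprod (R : realType) (n : nat) (lam : 'I_n -> R) (al : 'I_n -> nat)
  : {poly R[i]} := \prod_(j < n) (1 + (lam j)%:C *: 'X) ^+ al j.

Lemma linprod_coef (R : realType) (n : nat) (lam : 'I_n -> R)
    (al : 'I_n -> nat) :
  (linprod lam al)`_0 = 1 /\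
  (linprod lam al)`_1 = \sum_(j < n) (lam j * (al j)%:R)%:C.
Proof.
pose K (A : {poly R[i]}) s := A`_0 = 1 /\ A`_1 = s.
have KM A s B t : K A s -> K B t -> K (A * B) (s + t).
  move=> [A0 A1] [B0 B1]; split; first by rewrite coef0M A0 B0 mulr1.
  by rewrite coefM big_ord_recr big_ord1 /= A0 A1 B0 B1 mul1r mulr1 addrC.
have K1 : K 1 0 by split; rewrite coef1.
apply: (big_ind2 K) => // j _.
rewrite rmorphM rmorph_nat /= mulr_natr.
elim: (al j) => [|k IH]; first by rewrite expr0.
rewrite exprS mulrS; apply: KM => //.
by split; rewrite coefD coef1 coefZ coefX ?mulr0 ?mulr1 ?addr0 ?add0r.
Qed.

Lemma linprod_horner (R : realType) (n : nat) (lam : 'I_n -> R)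
    (al : 'I_n -> nat) (x : R[i]) :
  (linprod lam al).[x] = \prod_(j < n) (1 + (lam j)%:C * x) ^+ al j.
Proof.
rewrite horner_prod; apply: eq_bigr => j _.
by rewrite horner_exp hornerD hornerZ hornerX hornerC.
Qed.

(** The sub-mean value inequality on complex lines, i.e. the second half of
    plurisubharmonicity. *)
Definition submean (R : realType) (n : nat) (f : 'rV[R[i]]_n -> R) : Prop :=
  forall a b : 'rV[R[i]]_n,
    ((2 * pi * f a)%R%:E <=
     \int[lebesgue_measure]_(t in `[0%R, (2 * pi)%R]%classic)
       (f (a + cexpi t *: b))%:E)%E.

(** Nonnegativity at [z] of the Levi form of [P] in the direction
    [(lam_j * z_j)_j], which multiplies the term [z^alpha * zbar^beta] by
    [(sum_j lam_j alpha_j) * (sum_j lam_j beta_j)]. *)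
Lemma levi_ge0 (R : realType) (n : nat) (P : cpoly R n) (lam : 'I_n -> R)
    (z : 'rV[R[i]]_n) :
  submean (fun z => complex.Re (ceval P z)) ->
  0 <= complex.Re (\sum_(m <- msupp P)
    (\sum_(j < n) (lam j * (hexp m j)%:R)%:C) *
    (\sum_(j < n) (lam j * (aexp m j)%:R)%:C) * (mcoeff m P * cmon m z)).
Proof.
move=> smP.
pose A m := linprod lam (hexp m); pose B m := linprod lam (aexp m).
pose y m := mcoeff m P * cmon m z.
pose K m := (maxn (size (A m)) (size (B m))).+2.
(* [p.[e ^+ 2]] is the mean of [P] over the circle of radius [e] centred at
   [z] in the direction [(lam_j * z_j)_j]; its linear coefficient is the Levi
   form. *)
pose p : {poly R} := \sum_(m <- msupp P)
  \poly_(k < K m) complex.Re (y m * ((A m)`_k * (B m)`_k)).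
have pE s : p.[s] = \sum_(m <- msupp P)
    \sum_(k < K m) complex.Re (y m * ((A m)`_k * (B m)`_k)) * s ^+ k.
  by rewrite horner_sum; apply: eq_bigr => m _; rewrite horner_poly.
pose b (e : R) : 'rV[R[i]]_n := \row_j (e%:C * (lam j)%:C * z ord0 j).
have circ e : circle_mean (fun t => complex.Re (ceval P (z + cexpi t *: b e)))
    p.[e ^+ 2].
  have sA m : (size (A m) <= K m)%N by rewrite /K !leqW ?leq_maxl.
  have sB m : (size (B m) <= K m)%N by rewrite /K !leqW ?leq_maxr.
  rewrite pE; apply: circle_mean_ext (circle_mean_sum (msupp P)
    (fun m => circle_mean_poly (y m) e (sA m) (sB m))) => t.
  rewrite cevalE Re_sum; apply: eq_bigr => m _; congr (complex.Re _).
  rewrite /y -mulrA; congr (_ * _).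
  rewrite /A /B !linprod_horner mulrC.
  pose c : 'rV[R[i]]_n := \row_j (1 + (lam j)%:C * (e%:C * cexpi t)).
  have -> : z + cexpi t *: b e = \row_j (c ord0 j * z ord0 j).
    by apply/rowP => j; rewrite !mxE; ring.
  rewrite cmon_mul; congr (_ * _); rewrite /cmon; congr (_ * _).
    by apply: eq_bigr => j _; rewrite mxE.
  apply: eq_bigr => j _; rewrite mxE; congr (_ ^+ _).
  move: (cexpi t) => [x1 x2]; simpc; congr (_ +i* _); ring.
have p1 : complex.Re (\sum_(m <- msupp P)
    (\sum_(j < n) (lam j * (hexp m j)%:R)%:C) *
    (\sum_(j < n) (lam j * (aexp m j)%:R)%:C) * y m) = p`_1.
  rewrite coef_sum Re_sum; apply: eq_bigr => m _.
  rewrite coef_poly /= mulrC; congr (complex.Re (_ * _)).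
  by rewrite (linprod_coef lam (hexp m)).2 (linprod_coef lam (aexp m)).2.
rewrite p1; apply: coef1_ge0 => e.
have p0 : p.[0] = complex.Re (ceval P z).
  rewrite horner_coef0 coef_sum cevalE Re_sum; apply: eq_bigr => m _.
  rewrite coef_poly /= (linprod_coef lam (hexp m)).1.
  by rewrite (linprod_coef lam (aexp m)).1 !mulr1.
have := smP z (b e); rewrite (circle_mean_integral (circ e)) lee_fin p0.
by rewrite ler_pM2l // mulr_gt0 ?pi_gt0.
Qed.

(** The degree of the exponent [e] for the weights [a]. *)
Definition wsum (n : nat) (a e : 'I_n -> nat) : nat := (\sum_(j < n) a j * e j)%N.

(** If a real polynomial satisfying the sub-mean value inequality is
    homogeneous of the same degree [E], in [z] and its conjugate together, for
    two systems of weights [a] and [b], then only the terms whose holomorphic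
    degrees for [a] and [b] agree contribute to its values. *)
Lemma balanced_ceval (R : realType) (n : nat) (P : cpoly R n)
    (a b : 'I_n -> nat) (E : nat) :
  real_valued P -> submean (fun z => complex.Re (ceval P z)) ->
  (forall m, m \in msupp P ->
     (wsum a (hexp m) + wsum a (aexp m) = E)%N /\
     (wsum b (hexp m) + wsum b (aexp m) = E)%N) ->
  forall z, ceval P z =
    \sum_(m <- msupp P | wsum a (hexp m) == wsum b (hexp m))
       mcoeff m P * cmon m z.
Proof.
move=> rP smP hE z.
pose p m := (wsum a (hexp m) + wsum b (aexp m))%N.
have pE m : m \in msupp P -> (p m <= 2 * E)%N.
  by move=> /hE[]; rewrite /p; lia.
pose lam j : R := (a j)%:R - (b j)%:R.
have lamE e : \sum_(j < n) (lam j * (e j)%:R)%:C =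
    (wsum a e)%:R - (wsum b e)%:R :> R[i].
  rewrite /wsum !natr_sum -sumrB; apply: eq_bigr => j _.
  by rewrite rmorphM rmorphB !rmorph_nat !natrM mulrBl.
(* For [|w| = 1], [rot w] turns [z_j] by [a_j - b_j] times the angle of
   [w]. *)
pose rot (w : R[i]) : 'rV[R[i]]_n := \row_j (w ^+ a j * conjc w ^+ b j).
have rotE w m : m \in msupp P ->
    cmon m (rot w) = w ^+ p m * conjc w ^+ (2 * E - p m).
  move=> /hE[aE bE].
  have -> : (2 * E - p m = wsum b (hexp m) + wsum a (aexp m))%N by rewrite /p; lia.
  have -> : cmon m (rot w) =
    (w ^+ wsum a (hexp m) * conjc w ^+ wsum b (hexp m)) *
    (conjc w ^+ wsum a (aexp m) * w ^+ wsum b (aexp m)).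
    rewrite /cmon /wsum !expr_sum.
    rewrite -[X in _ = X * _]big_split -[X in _ = _ * X]big_split /=.
    congr (_ * _); apply: eq_bigr => j _; rewrite mxE.
      by rewrite exprMn -!exprM.
    by rewrite rmorphM !rmorphXn /= conjcK exprMn -!exprM.
  by rewrite /p !exprD; ring.
have rotP w : ceval P (\row_j (rot w ord0 j * z ord0 j)) =
    \sum_(m <- msupp P) mcoeff m P * cmon m z *
       (w ^+ p m * conjc w ^+ (2 * E - p m)).
  rewrite cevalE; apply: eq_big_seq => m mP.
  by rewrite cmon_mul rotE //; ring.
rewrite cevalE; rewrite (trig_rigidity (p := p) (E := E)) //.
- rewrite big_seq_cond [RHS]big_seq_cond; apply: eq_bigl => m.
  by case mP: (m \in _) => //=; have [] := hE _ mP; rewrite /p; lia.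
(* With [lam = a - b], homogeneity turns [(sum lam alpha) * (sum lam beta)]
   into [- (p m - E) ^+ 2]. *)
- move=> w w1.
  have := levi_ge0 lam (\row_j (rot w ord0 j * z ord0 j)) smP.
  rewrite -oppr_ge0; congr (_ <= _); rewrite !Re_sum -sumrN.
  apply: eq_big_seq => m mP; rewrite !lamE cmon_mul rotE //.
  have [aE bE] := hE _ mP.
  have -> : (wsum a (aexp m))%:R = E%:R - (wsum a (hexp m))%:R :> R[i].
    by rewrite -aE natrD; ring.
  have -> : (wsum b (aexp m))%:R = E%:R - (wsum b (hexp m))%:R :> R[i].
    by rewrite -bE natrD; ring.
  have -> : (p m)%:R = (wsum a (hexp m))%:R + (E%:R - (wsum b (hexp m))%:R) :> R[i].
    by rewrite /p natrD -[in RHS]bE natrD; ring.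
  rewrite -[RHS](raddfN (@complex.Re R : Rcomplex R -> R)) /=.
  by congr (complex.Re _); ring.
- by move=> w w1; rewrite -rotP; exact: rP.
Qed.

(** * Splitting off the first variables *)

Lemma big_head_tail (T : Type) (idx : T) (op : Monoid.com_law idx) (n l : nat)
    (le_ln : (l <= n)%N) (F : 'I_n -> T) :
  \big[op/idx]_(i < n) F i =
  op (\big[op/idx]_(j < l) F (head_ord le_ln j))
     (\big[op/idx]_(j < n - l) F (tail_ord le_ln j)).
Proof.
rewrite (reindex (cast_ord (subnKC le_ln))) /=; last first.
  by exists (cast_ord (esym (subnKC le_ln))) => i _; rewrite ?cast_ordK ?cast_ordKV.
rewrite big_split_ord /=; congr (op _ _); apply: eq_bigr => j _.
by congr F; exact: val_inj.
Qed.

Variant head_tail_spec (n l : nat) (le_ln : (l <= n)%N) : 'I_n -> Type :=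
| HeadOrd (j : 'I_l) : head_tail_spec le_ln (head_ord le_ln j)
| TailOrd (j : 'I_(n - l)) : head_tail_spec le_ln (tail_ord le_ln j).

Lemma head_tailP (n l : nat) (le_ln : (l <= n)%N) (i : 'I_n) :
  head_tail_spec le_ln i.
Proof.
rewrite -(cast_ordKV (subnKC le_ln) i).
case: (split_ordP (cast_ord (esym (subnKC le_ln)) i)) => j ->.
  by rewrite (_ : cast_ord _ _ = head_ord le_ln j);
    [exact: HeadOrd|exact: val_inj].
exact: TailOrd.
Qed.

(** The vector of [C^n] whose first [l] coordinates are [c] and whose last
    [n - l] coordinates are those of [w]; the cast identifies
    [l + (n - l)] with [n]. *)
Definition head_cst (R : realType) (n l : nat) (le_ln : (l <= n)%N) (c : R[i])
    (w : 'rV[R[i]]_(n - l)) : 'rV[R[i]]_n :=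
  castmx (erefl 1%N, subnKC le_ln) (row_mx (const_mx c : 'rV_l) w).

Lemma head_cst_head (R : realType) (n l : nat) (le_ln : (l <= n)%N) (c : R[i])
    (w : 'rV[R[i]]_(n - l)) (i : 'I_1) (j : 'I_l) :
  head_cst le_ln c w i (head_ord le_ln j) = c.
Proof.
rewrite castmxE (_ : cast_ord _ (head_ord _ _) = lshift _ j); last exact: val_inj.
by rewrite row_mxEl mxE.
Qed.

Lemma head_cst_tail (R : realType) (n l : nat) (le_ln : (l <= n)%N) (c : R[i])
    (w : 'rV[R[i]]_(n - l)) (i : 'I_1) (j : 'I_(n - l)) :
  head_cst le_ln c w i (tail_ord le_ln j) = w i j.
Proof.
by rewrite castmxE /tail_ord cast_ordK row_mxEr !ord1.
Qed.

Lemma head_cst_affine (R : realType) (n l : nat) (le_ln : (l <= n)%N)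
    (c x : R[i]) (a b : 'rV[R[i]]_(n - l)) :
  head_cst le_ln c (a + x *: b) = head_cst le_ln c a + x *: head_cst le_ln 0 b.
Proof.
apply/rowP => i; rewrite !mxE.
by case: (head_tailP le_ln i) => j;
  rewrite ?head_cst_head ?head_cst_tail ?mulr0 ?addr0 ?mxE.
Qed.

(** Restricting to an affine subspace preserves plurisubharmonicity. *)
Lemma plurisubharmonic_head_cst (R : realType) (n l : nat) (le_ln : (l <= n)%N)
    (c : R[i]) (f : 'rV[R[i]]_n -> R) :
  plurisubharmonic f -> plurisubharmonic (fun w => f (head_cst le_ln c w)).
Proof.
move=> [lf sf]; split; last first.
  move=> a b; apply: le_trans (sf _ (head_cst le_ln 0 b)) _.
  by under [leRHS]eq_integral do rewrite head_cst_affine.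
move=> w t /lf[V [B nB sB] fV].
exists (fun v => V (head_cst le_ln c v)); last by move=> v /fV.
(* A neighbourhood of a matrix contains a product of neighbourhoods of its
   entries, so it suffices to keep the factors at the tail coordinates. *)
exists (fun i j => B i (tail_ord le_ln j)).
  by move=> i j; have := nB i (tail_ord le_ln j); rewrite head_cst_tail.
move=> v hv; apply: sB => i q; case: (head_tailP le_ln q) => j.
  have := nB i (head_ord le_ln j); rewrite !head_cst_head.
  exact: nbhs_singleton.
by rewrite head_cst_tail; exact: hv.
Qed.

Lemma mcoeff_sum_neq0 (R : realType) (N N' : nat) (r : seq (multinom N))
    (c : pred (multinom N)) (a : multinom N -> R[i])
    (f : multinom N -> multinom N') (m : multinom N') :
  mcoeff m (\sum_(i <- r | c i) a i *: mpolyX _ (f i)) != 0 ->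
  exists i, [/\ i \in r, c i & f i = m].
Proof.
rewrite raddf_sum /=; apply: contra_neqP => nex.
rewrite big_seq_cond big1 // => i /andP[ir ci].
rewrite mcoeffZ mcoeffX; case: eqP => [fm|]; last by rewrite mulr0.
by case: nex; exists i.
Qed.

Lemma ceval_sum (R : realType) (n : nat) (I : Type) (r : seq I) (c : pred I)
    (a : I -> R[i]) (f : I -> multinom (n + n)) (z : 'rV[R[i]]_n) :
  ceval (\sum_(i <- r | c i) a i *: mpolyX _ (f i) : cpoly R n) z =
  \sum_(i <- r | c i) a i * cmon (f i) z.
Proof.
rewrite /ceval raddf_sum /=; apply: eq_bigr => i _.
by rewrite mevalZ mevalX meval_cmon.
Qed.

(** [k - D] divides [d_j * T] for every [j], hence also [D * T] and
    [k * T = (k - D) * T + D * T]; so it divides [g * T], and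
    [s] is the quotient of [T] by [(k - D) / g]. *)
Lemma balanced_exponents (l : nat) (d al : 'I_l -> nat) (k D g T : nat) :
  D = (\sum_(j < l) d j)%N -> (D < k)%N ->
  g = gcdn (\big[gcdn/0%N]_(j < l) d j) k ->
  (forall j, (k - D) * al j = d j * T)%N ->
  exists s, T = ((k - D) %/ g * s)%N /\ forall j, al j = (d j %/ g * s)%N.
Proof.
move=> DE Dk gE bal.
have g_gt0 : (0 < g)%N by rewrite gE gcdn_gt0 (leq_trans _ Dk) // orbT.
have gd j : (g %| d j)%N.
  rewrite gE (dvdn_trans (dvdn_gcdl _ _)) //.
  by rewrite (bigD1 j) //= dvdn_gcdl.
have gk : (g %| k)%N by rewrite gE dvdn_gcdr.
have gkD : (g %| k - D)%N by rewrite dvdn_sub // DE dvdn_sum.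
have dT j : (k - D %| T * d j)%N by rewrite mulnC -bal dvdn_mulr.
have kT : (k - D %| T * k)%N.
  have TD : (k - D %| T * D)%N.
    by rewrite [X in (_ %| _ * X)%N]DE big_distrr dvdn_sum.
  by rewrite -[X in (_ %| T * X)%N](subnK (ltnW Dk)) mulnDr dvdn_add // dvdn_mull.
have gT : (k - D %| T * g)%N.
  rewrite gE muln_gcdr dvdn_gcd kT andbT.
  elim/big_ind: _ => // [|x y hx hy]; first by rewrite muln0 dvdn0.
  by rewrite muln_gcdr dvdn_gcd hx hy.
have /dvdnP[s Ts] : ((k - D) %/ g %| T)%N.
  by rewrite -(dvdn_pmul2r g_gt0) divnK.
exists s; split=> [|j]; first by rewrite mulnC.
have e_gt0 : (0 < k - D)%N by rewrite subn_gt0.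
apply/eqP; rewrite -(eqn_pmul2l e_gt0) bal Ts.
rewrite -{1}(divnK (gd j)) -{2}(divnK gkD); apply/eqP; ring.
Qed.

(** * Balanced terms *)

(** The monomial obtained from [m] by erasing the first [l] variables, i.e. by
    giving them the value [1]. *)
Definition tail_mnm (n l : nat) (le_ln : (l <= n)%N) (m : multinom (n + n)) :
    multinom ((n - l) + (n - l)) :=
  Multinom (mktuple (fun i => match fintype.split i with
    | inl j => hexp m (tail_ord le_ln j)
    | inr j => aexp m (tail_ord le_ln j)
    end)).

Lemma hexp_tail_mnm (n l : nat) (le_ln : (l <= n)%N) (m : multinom (n + n)) j :
  hexp (tail_mnm le_ln m) j = hexp m (tail_ord le_ln j).
Proof. by rewrite /hexp mnmE (unsplitK (inl j : 'I_(n - l) + 'I_(n - l))). Qed.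

Lemma aexp_tail_mnm (n l : nat) (le_ln : (l <= n)%N) (m : multinom (n + n)) j :
  aexp (tail_mnm le_ln m) j = aexp m (tail_ord le_ln j).
Proof. by rewrite /aexp mnmE (unsplitK (inr j : 'I_(n - l) + 'I_(n - l))). Qed.

Lemma hdeg_tail_mnm (n l : nat) (le_ln : (l <= n)%N) (m : multinom (n + n)) :
  hdeg (tail_mnm le_ln m) = (\sum_(j < n - l) hexp m (tail_ord le_ln j))%N.
Proof. by apply: eq_bigr => j _; rewrite hexp_tail_mnm. Qed.

Lemma adeg_tail_mnm (n l : nat) (le_ln : (l <= n)%N) (m : multinom (n + n)) :
  adeg (tail_mnm le_ln m) = (\sum_(j < n - l) aexp m (tail_ord le_ln j))%N.
Proof. by apply: eq_bigr => j _; rewrite aexp_tail_mnm. Qed.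

Lemma hdeg_head_tail (n l : nat) (le_ln : (l <= n)%N) (m : multinom (n + n)) :
  hdeg m = (\sum_(j < l) hexp m (head_ord le_ln j) + hdeg (tail_mnm le_ln m))%N.
Proof. by rewrite hdeg_tail_mnm /hdeg (big_head_tail _ le_ln). Qed.

Lemma adeg_head_tail (n l : nat) (le_ln : (l <= n)%N) (m : multinom (n + n)) :
  adeg m = (\sum_(j < l) aexp m (head_ord le_ln j) + adeg (tail_mnm le_ln m))%N.
Proof. by rewrite adeg_tail_mnm /adeg (big_head_tail _ le_ln). Qed.

Lemma cmon_head_tail (R : realType) (n l : nat) (le_ln : (l <= n)%N)
    (m : multinom (n + n)) (z : 'rV[R[i]]_n) :
  cmon m z =
  (\prod_(j < l) z ord0 (head_ord le_ln j) ^+ hexp m (head_ord le_ln j)) *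
  (\prod_(j < l) conjc (z ord0 (head_ord le_ln j)) ^+ aexp m (head_ord le_ln j))
  * cmon (tail_mnm le_ln m) (tail_vec le_ln z).
Proof.
rewrite /cmon !(big_head_tail _ le_ln) /= mulrACA; congr (_ * (_ * _)).
  by apply: eq_bigr => j _; rewrite hexp_tail_mnm mxE.
by apply: eq_bigr => j _; rewrite aexp_tail_mnm mxE.
Qed.

Lemma cmon_scale (R : realType) (n : nat) (m : multinom (n + n)) (c : R[i])
    (z : 'rV[R[i]]_n) :
  cmon m (c *: z) = c ^+ hdeg m * conjc c ^+ adeg m * cmon m z.
Proof.
have -> : c *: z = \row_j ((\row_(j < n) c) ord0 j * z ord0 j).
  by apply/rowP => j; rewrite !mxE.
rewrite cmon_mul /cmon /hdeg /adeg !expr_sum; congr (_ * _ * _).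
  by apply: eq_bigr => j _; rewrite mxE.
by apply: eq_bigr => j _; rewrite mxE.
Qed.

Lemma cmon_head_cst1 (R : realType) (n l : nat) (le_ln : (l <= n)%N)
    (m : multinom (n + n)) (w : 'rV[R[i]]_(n - l)) :
  cmon m (head_cst le_ln 1 w) = cmon (tail_mnm le_ln m) w.
Proof.
rewrite (cmon_head_tail le_ln) !big1 => [|j _|j _]; last 2 first.
- by rewrite head_cst_head conjc1 expr1n.
- by rewrite head_cst_head expr1n.
rewrite !mul1r; congr cmon.
by apply/rowP => j; rewrite mxE head_cst_tail.
Qed.

Lemma tail_degree (n l : nat) (le_ln : (l <= n)%N) (m : multinom (n + n))
    (d : 'I_l -> nat) (k : nat) :
  (hdeg m + adeg m = 2 * k)%N ->
  (forall j, hexp m (head_ord le_ln j) + aexp m (head_ord le_ln j) = 2 * d j)%N ->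
  (hdeg (tail_mnm le_ln m) + adeg (tail_mnm le_ln m) =
   2 * k - 2 * \sum_(j < l) d j)%N.
Proof.
move=> hk hd; have : (\sum_(j < l) hexp m (head_ord le_ln j) +
    \sum_(j < l) aexp m (head_ord le_ln j) = 2 * \sum_(j < l) d j)%N.
  by rewrite -big_split big_distrr; apply: eq_bigr => j _; exact: hd.
by move: hk; rewrite (hdeg_head_tail le_ln) (adeg_head_tail le_ln); lia.
Qed.

(** [balanced_ceval] for the weights equal to [k - D] on the [j]-th variable
    and to [d j] on each of the last [n - l] variables; both degrees are then
    [2 * (k - D) * d j]. *)
Lemma balanced_dir (R : realType) (n k l : nat) (le_ln : (l <= n)%N)
    (P : cpoly R n) (d : 'I_l -> nat) (D : nat) (j : 'I_l) :
  psh_poly P -> homogeneous (2 * k) P ->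
  (forall j, homogeneous_in (head_ord le_ln j) (2 * d j) P) ->
  D = (\sum_(j < l) d j)%N ->
  forall z, ceval P z =
    \sum_(m <- msupp P | ((k - D) * hexp m (head_ord le_ln j) ==
                          d j * hdeg (tail_mnm le_ln m))%N)
       mcoeff m P * cmon m z.
Proof.
move=> [rP [_ smP]] hP hdP DE z.
pose a i := if i == head_ord le_ln j then (k - D)%N else 0%N.
pose b i := if (l <= i)%N then d j else 0%N.
have aE e : wsum a e = ((k - D) * e (head_ord le_ln j))%N.
  rewrite /wsum (bigD1 (head_ord le_ln j)) //= /a eqxx big1 ?addn0 //.
  by move=> i /negPf ->.
have bE e : wsum b e = (d j * \sum_(i < n - l) e (tail_ord le_ln i))%N.
  rewrite /wsum (big_head_tail _ le_ln) /= big1 ?add0n.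
    by rewrite big_distrr; apply: eq_bigr => i _; rewrite /b /= leq_addr.
  by move=> i _; rewrite /b /= leqNgt ltn_ord.
rewrite (balanced_ceval (a := a) (b := b) (E := 2 * (k - D) * d j) rP smP).
  by apply: eq_bigl => m; rewrite aE bE hdeg_tail_mnm.
move=> m; rewrite mcoeff_msupp => mP; rewrite !aE !bE.
rewrite -hdeg_tail_mnm -adeg_tail_mnm -!mulnDr hdP //.
rewrite (@tail_degree _ _ le_ln _ d k) ?hP //; last by move=> i; exact: hdP.
rewrite -DE -mulnBr; split; ring.
Qed.

(** Discarding unbalanced terms for one index leaves the function unchanged,
    so the new polynomial satisfies the same hypotheses and the next index can
    be treated. *)
Lemma balanced_subpoly (R : realType) (n k l : nat) (le_ln : (l <= n)%N)
    (P : cpoly R n) (d : 'I_l -> nat) (D : nat) (s : seq 'I_l) :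
  psh_poly P -> homogeneous (2 * k) P ->
  (forall j, homogeneous_in (head_ord le_ln j) (2 * d j) P) ->
  D = (\sum_(j < l) d j)%N ->
  exists P' : cpoly R n, ceval P' =1 ceval P /\
    forall m, mcoeff m P' != 0 -> mcoeff m P != 0 /\
      forall j, j \in s -> ((k - D) * hexp m (head_ord le_ln j) =
                            d j * hdeg (tail_mnm le_ln m))%N.
Proof.
move=> pshP hP hdP DE; elim: s => [|j s [P' [ceP' suppP']]].
  by exists P.
have pshP' : psh_poly P'.
  by rewrite /psh_poly /real_valued (funext ceP').
have hP' : homogeneous (2 * k) P' by move=> m /suppP'[/hP].
have hdP' i : homogeneous_in (head_ord le_ln i) (2 * d i) P'.
  by move=> m /suppP'[/hdP].
have cE := balanced_dir j pshP' hP' hdP' DE.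
exists (\sum_(m <- msupp P' | ((k - D) * hexp m (head_ord le_ln j) ==
    d j * hdeg (tail_mnm le_ln m))%N) mcoeff m P' *: mpolyX _ m).
split=> [z|m /mcoeff_sum_neq0[m' [m'P /eqP bal <-]]].
  by rewrite ceval_sum -cE ceP'.
have [m'P' bal'] := suppP' m' (etrans (esym (mcoeff_msupp _ _)) m'P).
split=> // i; rewrite inE => /orP[/eqP->//|]; exact: bal'.
Qed.

Theorem theorem2p4 (R : realType) (n k l : nat) (P : cpoly R n)
    (d : 'I_l -> nat) (D g : nat)
    (n_ge2 : (2 <= n)%N)
    (k_ge1 : (1 <= k)%N)
    (P_nonconst : ~ exists c : R[i], P = mpolyC (n + n) c)
    (P_psh : psh_poly P)
    (P_noph : no_pluriharmonic_terms P)
    (P_hom : homogeneous (2 * k) P)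
    (l_ge1 : (1 <= l)%N)
    (lt_ln : (l < n)%N)
    (d_gt0 : forall j : 'I_l, (0 < d j)%N)
    (P_homd : forall j : 'I_l,
        homogeneous_in (head_ord (ltnW lt_ln) j) (2 * d j) P)
    (D_def : D = (\sum_(j < l) d j)%N)
    (D_lt_k : (D < k)%N)
    (g_def : g = gcdn (\big[gcdn/0%N]_(j < l) d j) k) :
  exists Q : cpoly R (n - l),
    [/\ psh_poly Q,
        no_pluriharmonic_terms Q,
        homogeneous (2 * k - 2 * D) Q,
        (forall m : multinom ((n - l) + (n - l)), mcoeff m Q != 0 ->
           ((k - D) %/ g %| hdeg m)%N /\ ((k - D) %/ g %| adeg m)%N)
      & forall (z : 'rV[R[i]]_n) (tau : R[i]),
          tau ^+ ((k - D) %/ g) =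
            \prod_(j < l) z ord0 (head_ord (ltnW lt_ln) j) ^+ (d j %/ g) ->
          ceval P z = ceval Q (tau *: tail_vec (ltnW lt_ln) z)].
Proof.
set le_ln := ltnW lt_ln.
have [P' [ceP' suppP']] :=
  balanced_subpoly (enum 'I_l) P_psh P_hom P_homd D_def.
pose Q : cpoly R (n - l) :=
  \sum_(m <- msupp P') mcoeff m P' *: mpolyX _ (tail_mnm le_ln m).
have QE w : ceval Q w = ceval P (head_cst le_ln 1 w).
  rewrite -ceP' [RHS]cevalE /Q ceval_sum.
  by apply: eq_bigr => m _; rewrite cmon_head_cst1.
have suppQ m : mcoeff m Q != 0 ->
    exists2 m', mcoeff m' P' != 0 & m = tail_mnm le_ln m'.
  by case/mcoeff_sum_neq0 => m' [+ _ <-]; rewrite mcoeff_msupp; exists m'.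
have bal m : mcoeff m P' != 0 -> forall j, ((k - D) * hexp m (head_ord le_ln j) =
    d j * hdeg (tail_mnm le_ln m))%N.
  by move=> /suppP'[_ balm] j; apply: balm; rewrite mem_enum.
have tail_hom m : mcoeff m P' != 0 ->
    (hdeg (tail_mnm le_ln m) + adeg (tail_mnm le_ln m) = 2 * (k - D))%N.
  move=> /suppP'[mP _]; rewrite mulnBr D_def; apply: tail_degree => [|j].
    exact: P_hom.
  exact: P_homd.
have bal_a m : mcoeff m P' != 0 -> forall j,
    ((k - D) * aexp m (head_ord le_ln j) = d j * adeg (tail_mnm le_ln m))%N.
  move=> mP' j; have := bal _ mP' j; have := tail_hom _ mP'.
  have [/(P_homd j)] := suppP' _ mP'; rewrite -/le_ln; nia.
have hdiv m mP' := balanced_exponents D_def D_lt_k g_def (bal m mP').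
have adiv m mP' := balanced_exponents D_def D_lt_k g_def (bal_a m mP').
exists Q; split.
- split; first by move=> w; rewrite QE; exact: P_psh.1.
  have -> : (fun w => complex.Re (ceval Q w)) =
      (fun w => complex.Re (ceval P (head_cst le_ln 1 w))).
    by apply/funext => w; rewrite QE.
  exact: plurisubharmonic_head_cst P_psh.2.
- move=> m /suppQ[m' mP' ->]; have [mP _] := suppP' _ mP'.
  have [h0 a0] := P_noph _ mP.
  have kD0 : (0 < k - D)%N by rewrite subn_gt0.
  split; rewrite lt0n; apply/eqP => T0.
  + move: h0; rewrite (hdeg_head_tail le_ln) T0 big1 // => j _.
    have /eqP := bal _ mP' j.
    by rewrite T0 muln0 muln_eq0 -leqn0 leqNgt kD0 => /eqP.
  + move: a0; rewrite (adeg_head_tail le_ln) T0 big1 // => j _.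
    have /eqP := bal_a _ mP' j.
    by rewrite T0 muln0 muln_eq0 -leqn0 leqNgt kD0 => /eqP.
- by move=> m /suppQ[m' mP' ->]; rewrite tail_hom // mulnBr.
- move=> m /suppQ[m' mP' ->].
  have [s [-> _]] := hdiv _ mP'; have [t [-> _]] := adiv _ mP'.
  by rewrite !dvdn_mulr.
- move=> z tau tauE; rewrite -ceP' cevalE /Q ceval_sum.
  apply: eq_big_seq => m; rewrite mcoeff_msupp => mP'; congr (_ * _).
  rewrite (cmon_head_tail le_ln) cmon_scale; congr (_ * _ * _).
    have [s [-> hs]] := hdiv _ mP'; rewrite exprM tauE -prodrXl.
    by apply: eq_bigr => j _; rewrite hs exprM.
  have [s [-> hs]] := adiv _ mP'.
  rewrite exprM -(rmorphXn (@conjc R)) tauE rmorph_prod -prodrXl.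
  by apply: eq_bigr => j _; rewrite hs exprM rmorphXn.
Qed.
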